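(* Let $D=\{1,\dots,d\}$ and let $\mathcal E:M_d(\mathbb C)\otimes M_d(\mathbb C)\to M_d(\mathbb C)$ be a transition expectation of the form $$\mathcal E(x)=\overline{\mathrm{Tr}}_2\Bigl(\sum_{j\in D_{\mathcal E}}K_j^*xK_j\Bigr),\qquad K_j=\sum_{h,h'\in D}e_{hh'}\otimes K_{j,h,h'},$$ mapping $D_e\otimes D_e$ into $D_e$. For $r,m,i\in D$ put $$P_{r;m,i}:=\Bigl\langle e_i,\Bigl(\sum_{j\in D_{\mathcal E}}K_{j,m,r}K_{j,m,r}^*\Bigr)e_i\Bigr\rangle,\qquad P_{r;m}:=\sum_{i\in D}P_{r;m,i}.$$ Then $P\equiv(P_{r;m,i})$ is a $(d\times d^2)$-stochastic matrix, namely $$P_{r;m,i}\ge0\quad\forall m,r,i\in D,\qquad\sum_{m,i\in D}P_{r;m,i}=1\quad\forall r\in D.\qquad(1)$$ Moreover, let $\varphi\equiv(\varphi_0,\mathcal E)$ be the homogeneous quantum Markov chain on $\bigotimes_{\mathbb N}M_d(\mathbb C)$ with initial state $\varphi_0=\mathrm{Tr}\bigl(\sum_{i\in D}p^{(0)}_ie_{ii}\,\cdot\,\bigr)$, where $p^{(0)}_i\ge0$, $\sum_{i\in D}p^{(0)}_i=1$. Then for all $n\in\mathbb N$, $i_0,\dots,i_n\in D$, $$\mathcal E(e_{i_0i_0}\otimes\mathcal E(e_{i_1i_1}\otimes\cdots\otimes\mathcal E(e_{i_{n-1}i_{n-1}}\otimes\mathcal E(e_{i_ni_n}\otimes1))\cdots))=\sum_{r_0,\dots,r_n\in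 D}P_{r_0;i_0,r_1}P_{r_1;i_1,r_2}\cdots P_{r_{n-1};i_{n-1},r_n}P_{r_n;i_n}\,e_{r_0r_0}.$$ In particular $$\varphi(e_{i_0i_0}\otimes e_{i_1i_1}\otimes\cdots\otimes e_{i_ni_n})=\sum_{r_0,\dots,r_n\in D}p^{(0)}_{r_0}P_{r_0;i_0,r_1}P_{r_1;i_1,r_2}\cdots P_{r_{n-1};i_{n-1},r_n}P_{r_n;i_n}.$$ Conversely, given a family of numbers $(P_{r;m,i})_{r,m,i\in D}$ satisfying (1) and a probability measure $(p^{(0)}_i)_{i\in D}$ on $D$, there exists a unique classical stochastic process $(X_n)_{n\in\mathbb N}$ with state space $D$ whose joint probabilities are, for all $n\in\mathbb N$ and $i_0,\dots,i_n\in D$, $$\mathrm{Prob}(X_0=i_0,X_1=i_1,\dots,X_n=i_n)=\sum_{r_0,\dots,r_n\in D}p^{(0)}_{r_0}P_{r_0;i_0,r_1}P_{r_1;i_1,r_2}\cdots P_{r_{n-1};i_{n-1},r_n}P_{r_n;i_n},$$ with $P_{r;m}=\sum_{i\in D}P_{r;m,i}$.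
   Context: $(e_j)_{j\in D}$ is a fixed orthonormal basis of $\mathbb C^d$, $e_{hk}=e_he_k^*$ the associated matrix units of $M_d(\mathbb C)$, and $D_e=\{\sum_hx_he_{hh}:x_h\in\mathbb C\}$ the diagonal subalgebra. $\overline{\mathrm{Tr}}_2(a\otimes b)=a\,\mathrm{Tr}(b)$. $D_{\mathcal E}$ is a finite index set, $K_j\in M_d(\mathbb C)\otimes M_d(\mathbb C)$ and $K_{j,h,h'}\in M_d(\mathbb C)$. A transition expectation is a completely positive identity preserving linear map. The homogeneous quantum Markov chain determined by $(\varphi_0,\mathcal E)$ is the state on $\bigotimes_{\mathbb N}M_d(\mathbb C)$ (algebraic tensor product) with $\varphi(a_0\otimes a_1\otimes\cdots\otimes a_n)=\varphi_0(\mathcal E(a_0\otimes\mathcal E(a_1\otimes\cdots\otimes\mathcal E(a_n\otimes1)\cdots)))$ (units in the remaining factors). Uniqueness of the classical process is up to stochastic equivalence (equality of joint probabilities). *)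

(* Defs.v *)
From HB Require Import structures.
From mathcomp Require Import all_boot all_order all_algebra.
From mathcomp Require Import sesquilinear spectral.
From mathcomp.real_closed Require Import complex mxtens.
From mathcomp Require Import all_classical all_reals all_analysis.

Set Implicit Arguments.
Unset Strict Implicit.
Unset Printing Implicit Defensive.

Import Order.TTheory GRing.Theory Num.Theory Num.Def.
Local Open Scope ring_scope.
Local Open Scope sesquilinear_scope.
Local Open Scope complex_scope.

(* M_m(C) ⊗ M_n(C) is realized as 'M[C]_(m * n) through the Kronecker product  *)
(* A *t B of mxtens, and A ^t* is the conjugate transpose.                     *)

Section MatrixMaps.
Variable C : numClosedFieldType.

Definition orthonormal_basis (d : nat) (e : 'I_d -> 'cV[C]_d) : Prop :=
  forall h k, ((e h)^t* *m e k) 0 0 = (h == k)%:R.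

Definition matrix_unit (d : nat) (e : 'I_d -> 'cV[C]_d) (h k : 'I_d) :
  'M[C]_d := e h *m (e k)^t*.

Definition ptrace2 (m n : nat) (x : 'M[C]_(m * n)) : 'M[C]_m :=
  \matrix_(i, j) \sum_(k < n) x (mxtens_index (i, k)) (mxtens_index (j, k)).

Lemma ptrace2_tens m n (a : 'M[C]_m) (b : 'M[C]_n) :
  ptrace2 (a *t b) = \tr b *: a.
Proof.
apply/matrixP => i j; rewrite !mxE mulr_suml.
by apply: eq_bigr => k _; rewrite tensmxE mulrC.
Qed.

Lemma ptrace2_is_linear m n : linear (@ptrace2 m n).
Proof.
move=> c x y; apply/matrixP => i j; rewrite !mxE mulr_sumr -big_split /=.
by apply: eq_bigr => k _; rewrite !mxE.
Qed.

Definition positive_mx (n : nat) (A : 'M[C]_n) : Prop :=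
  forall v : 'cV[C]_n, 0 <= (v^t* *m A *m v) 0 0.

(* id_k ⊗ F, acting on k x k block matrices with blocks in 'M_m. *)
Definition amplification (k m n : nat) (F : 'M[C]_m -> 'M[C]_n)
    (X : 'M[C]_(k * m)) : 'M[C]_(k * n) :=
  \matrix_(i, j)
    F (\matrix_(a, b) X (mxtens_index ((mxtens_unindex i).1, a))
                        (mxtens_index ((mxtens_unindex j).1, b)))
      (mxtens_unindex i).2 (mxtens_unindex j).2.

Lemma amplification_tens k m n (F : {linear 'M[C]_m -> 'M[C]_n})
    (a : 'M[C]_k) (b : 'M[C]_m) : amplification F (a *t b) = a *t F b.
Proof.
apply/matrixP => i j; rewrite [LHS]mxE [RHS]mxE.
set M := \matrix_(_, _) _.
have -> : M = a (mxtens_unindex i).1 (mxtens_unindex j).1 *: b.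
  by apply/matrixP => p q; rewrite !mxE !mxtens_indexK.
by rewrite linearZ mxE.
Qed.

Definition completely_positive (m n : nat) (F : 'M[C]_m -> 'M[C]_n) : Prop :=
  forall (k : nat) (X : 'M[C]_(k * m)),
    positive_mx X -> positive_mx (amplification F X).

Record transition_expectation (d : nat) (E : 'M[C]_(d * d) -> 'M[C]_d) : Prop :=
  TransitionExpectation {
    te_linear : linear E;
    te_completely_positive : completely_positive E;
    te_unital : E 1%:M = 1%:M
  }.

Definition diag_subalg (d : nat) (e : 'I_d -> 'cV[C]_d) (x : 'M[C]_d) : Prop :=
  exists c : 'I_d -> C, x = \sum_h c h *: matrix_unit e h h.

Definition tens_subspace (m n : nat) (U : 'M[C]_m -> Prop)
    (V : 'M[C]_n -> Prop) (x : 'M[C]_(m * n)) : Prop :=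
  exists s : seq ('M[C]_m * 'M[C]_n),
    (forall ab, ab \in s -> U ab.1 /\ V ab.2) /\
    x = \sum_(ab <- s) ab.1 *t ab.2.

(* E(a_0 ⊗ E(a_1 ⊗ ... E(a_n ⊗ 1)...)) for s = [:: a_0; ...; a_n]. *)
Definition nested (d : nat) (E : 'M[C]_(d * d) -> 'M[C]_d)
    (s : seq 'M[C]_d) : 'M[C]_d :=
  foldr (fun a x => E (a *t x)) 1%:M s.

End MatrixMaps.

(* The infinite algebraic tensor product of copies of M_d(C) is the inductive  *)
(* limit of the algebras A_n = 'M_(loc_dim d n) (the tensor factors 0, ..., n) *)
(* along the unital embeddings x |-> x ⊗ 1.  A functional on it is the         *)
(* compatible family of its restrictions to the A_n; since every element lies  *)
(* in some A_n, it is a state iff it is linear, unital and positive on each.   *)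
Section InfiniteTensorProduct.
Variable C : numClosedFieldType.

Fixpoint loc_dim (d n : nat) : nat :=
  if n is m.+1 then (loc_dim d m * d)%N else d.

(* a_0 ⊗ a_1 ⊗ ... ⊗ a_n *)
Fixpoint pure_tensor (d : nat) (a : nat -> 'M[C]_d) (n : nat) :
    'M[C]_(loc_dim d n) :=
  if n is m.+1 then pure_tensor a m *t a m.+1 else a 0%N.

Record infinite_tensor_state (d : nat)
    (phi : forall n, 'M[C]_(loc_dim d n) -> C) : Prop := InfiniteTensorState {
  its_compatible : forall n (x : 'M[C]_(loc_dim d n)),
    phi n.+1 (x *t (1%:M : 'M[C]_d)) = phi n x;
  its_linear : forall n, scalar (phi n);
  its_positive : forall n (x : 'M[C]_(loc_dim d n)), 0 <= phi n (x^t* *m x);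
  its_unital : forall n, phi n 1%:M = 1
}.

Record homogeneous_qmc (d : nat) (phi0 : 'M[C]_d -> C)
    (E : 'M[C]_(d * d) -> 'M[C]_d)
    (phi : forall n, 'M[C]_(loc_dim d n) -> C) : Prop := HomogeneousQMC {
  qmc_state : infinite_tensor_state phi;
  qmc_eq : forall (n : nat) (a : nat -> 'M[C]_d),
    phi n (pure_tensor a n) = phi0 (nested E (mkseq a n.+1))
}.

End InfiniteTensorProduct.

(* P r m i stands for P_{r;m,i}; here it is                                    *)
(* <e_i, (sum_j K_{j,m,r} K_{j,m,r}^* ) e_i>.                                  *)
Definition kraus_weight (C : numClosedFieldType) (d : nat)
    (e : 'I_d -> 'cV[C]_d) (J : finType) (Kc : J -> 'I_d -> 'I_d -> 'M[C]_d)
    (r m i : 'I_d) : C :=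
  ((e i)^t* *m (\sum_j Kc j m r *m (Kc j m r)^t*) *m e i) 0 0.

Section Weights.

Definition stochastic3 (F : numDomainType) (d : nat)
    (P : 'I_d -> 'I_d -> 'I_d -> F) : Prop :=
  (forall r m i, 0 <= P r m i) /\
  (forall r, \sum_m \sum_i P r m i = 1).

Definition probability_vector (F : numDomainType) (d : nat) (p : 'I_d -> F) :
    Prop :=
  (forall i, 0 <= p i) /\ \sum_i p i = 1.

Definition marginal (F : pzRingType) (d : nat) (P : 'I_d -> 'I_d -> 'I_d -> F)
    (r m : 'I_d) : F := \sum_i P r m i.

(* P_{r_0;i_0,r_1} ... P_{r_{n-1};i_{n-1},r_n} P_{r_n;i_n}; only the values    *)
(* i 0, ..., i n of the sequence i are used.                                   *)
Definition path_weight (F : pzRingType) (d : nat)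
    (P : 'I_d -> 'I_d -> 'I_d -> F) (n : nat) (i : nat -> 'I_d)
    (r : {ffun 'I_n.+1 -> 'I_d}) : F :=
  (\prod_(k < n) P (r (widen_ord (leqnSn n) k)) (i k) (r (lift ord0 k))) *
  marginal P (r ord_max) (i n).

Definition joint_weight (F : pzRingType) (d : nat) (p : 'I_d -> F)
    (P : 'I_d -> 'I_d -> 'I_d -> F) (n : nat) (i : nat -> 'I_d) : F :=
  \sum_(r : {ffun 'I_n.+1 -> 'I_d}) p (r ord0) * path_weight P i r.

End Weights.

Section ClassicalProcess.
Variable R : realType.
Local Open Scope classical_set_scope.

(* 'I_d carries the discrete sigma-algebra; measurability is stated directly   *)
(* because a measurableType is required to be inhabited.                       *)
Record process (d : nat) := Process {
  proc_disp : measure_display;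
  proc_space : measurableType proc_disp;
  proc_prob : probability proc_space R;
  proc_var : nat -> proc_space -> 'I_d;
  proc_measurable : forall n (A : set 'I_d), measurable (proc_var n @^-1` A)
}.

Arguments proc_var {d} p n _.

(* Prob(X_t = i_t for all t in ts) *)
Definition joint_prob (d : nat) (X : process d) (ts : seq nat)
    (i : nat -> 'I_d) : \bar R :=
  proc_prob X [set w | forall t, t \in ts -> proc_var X t w = i t].

Definition stochastically_equivalent (d : nat) (X Y : process d) : Prop :=
  forall (ts : seq nat) (i : nat -> 'I_d), joint_prob X ts i = joint_prob Y ts i.

Definition has_joint_weights (d : nat) (p : 'I_d -> R)
    (P : 'I_d -> 'I_d -> 'I_d -> R) (X : process d) : Prop :=
  forall (n : nat) (i : nat -> 'I_d),
    joint_prob X (iota 0 n.+1) i = (joint_weight p P n i)%:E.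

End ClassicalProcess.

(* Main.v *)
(* Since E maps D_e ⊗ D_e into D_e, E(e_mm ⊗ e_ii) is determined by its        *)
(* diagonal, which the Kraus form computes: E(e_mm ⊗ e_ii) = sum_r P_{r;m,i}   *)
(* e_rr.  Positivity and E(1) = 1 then give (1), and evaluating the nested     *)
(* expectations from the inside out gives sum_r B(i_0...i_n; r) e_rr, where    *)
(* B(m s; r) = sum_{r'} P_{r;m,r'} B(s; r'), B(empty; r) = 1, is the sum of    *)
(* path weights.                                                               *)
(* Conversely w(s) = sum_r p_r B(s; r) satisfies w(empty) = 1 and              *)
(* w(s) = sum_j w(s j), so the unit interval can be cut into nested half-open  *)
(* intervals of length w(s), one for each word s; the letters of the intervals *)
(* containing a uniform random point form the process.  Uniqueness: any joint  *)
(* probability is a finite sum of probabilities of initial segments.           *)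

Require Import Defs.
From HB Require Import structures.
From mathcomp Require Import all_boot all_order all_algebra.
From mathcomp Require Import sesquilinear spectral.
From mathcomp.real_closed Require Import complex mxtens.
From mathcomp Require Import all_classical all_reals all_analysis.

Import Order.TTheory GRing.Theory Num.Theory Num.Def.
Local Open Scope ring_scope.
Local Open Scope sesquilinear_scope.
Local Open Scope complex_scope.

(** Both halves reduce the sum over hidden paths to the one-letter recursion [word_weight]
    ([joint_weightE], [sum_path_weight_scale]). On the quantum side, duality of the partial trace
    turns the pairing of [E] with a diagonal unit into a trace over Kraus blocks
    ([transition_trace]). As [E] preserves the diagonal, these pairings give its diagonal values
    ([transition_diag]), and the nested expectations obey the same recursion ([nested_units]). On
    the classical side, stochasticity makes word weights consistent under appending a letter
    ([word_weight_rcons]), so words can label nested subintervals of the unit interval with Lebesgue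
    measure ([interval_coding_process]). Initial segments determine all joint probabilities
    ([joint_prob_total]). *)

(** * Sums over hidden paths as a recursion on words *)

Section PathSums.
Context {F : comPzRingType} {d : nat}.
Implicit Types (P : 'I_d -> 'I_d -> 'I_d -> F) (i : nat -> 'I_d).

(* Letters are consumed from time 0 on, starting in the hidden state [r]. *)
Fixpoint word_weight P (s : seq 'I_d) (r : 'I_d) : F :=
  if s is m :: s' then \sum_r' P r m r' * word_weight P s' r' else 1.

Lemma mkseqSl {T : Type} (f : nat -> T) n :
  mkseq f n.+1 = f 0%N :: mkseq (f \o succn) n.
Proof. by rewrite /mkseq /= (iotaDl 1 0) -map_comp. Qed.

Definition ffun_cons {n} (r0 : 'I_d) (r : {ffun 'I_n -> 'I_d}) :
    {ffun 'I_n.+1 -> 'I_d} :=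
  [ffun k => oapp r r0 (unlift ord0 k)].

Lemma path_weight_cons P n i r0 (r : {ffun 'I_n.+1 -> 'I_d}) :
  path_weight P i (ffun_cons r0 r) =
  P r0 (i 0%N) (r ord0) * path_weight P (i \o succn) r.
Proof.
have cons_lift k : ffun_cons r0 r (lift ord0 k) = r k.
  by rewrite ffunE liftK.
rewrite /path_weight big_ord_recl -!mulrA; congr (_ * _).
  rewrite cons_lift; congr (P _ _ _).
  by rewrite (_ : widen_ord _ _ = ord0) ?ffunE ?unlift_none //; apply: val_inj.
congr (_ * _).
  apply: eq_bigr => k _.
  have -> : widen_ord (leqnSn n.+1) (lift ord0 k) =
            lift ord0 (widen_ord (leqnSn n) k) by apply: val_inj.
  by rewrite !cons_lift.
have -> : ord_max = lift ord0 (ord_max : 'I_n.+1) by apply: val_inj.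
by rewrite cons_lift.
Qed.

(** Splitting off the initial state leaves a tail path with shifted letters, which is the recursion
    of [word_weight]. The marginal ending a path is its last letter followed by the empty word of
    weight 1. *)
Lemma sum_path_weight P n i r0 :
  \sum_(r : {ffun 'I_n.+1 -> 'I_d} | r ord0 == r0) path_weight P i r =
  word_weight P (mkseq i n.+1) r0.
Proof.
elim: n i r0 => [|n IHn] i r0.
  rewrite (big_pred1 [ffun=> r0]) => [|r]; last first.
    apply/eqP/eqP => [r0E|->]; last by rewrite ffunE.
    by apply/ffunP => k; rewrite ffunE ord1.
  rewrite /path_weight big_ord0 mul1r ffunE /marginal /=.
  by apply: eq_bigr => k _; rewrite mulr1.
rewrite (reindex_onto (ffun_cons r0) (fun r => [ffun k => r (lift ord0 k)])).
  transitivity (\sum_r' P r0 (i 0%N) r' *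
      word_weight P (mkseq (i \o succn) n.+1) r'); last by rewrite (mkseqSl i).
  rewrite (eq_bigl xpredT) => [|r]; last first.
    rewrite ffunE unlift_none eqxx /=.
    by apply/eqP/ffunP => k; rewrite !ffunE liftK.
  (* Grouping the tails by their own first state gives the sums of the induction hypothesis. *)
  rewrite (partition_big (fun r : {ffun 'I_n.+1 -> 'I_d} => r ord0) xpredT) //.
  apply: eq_bigr => r1 _; rewrite -IHn mulr_sumr.
  by apply: eq_bigr => r /eqP <-; rewrite path_weight_cons.
move=> r /eqP r0E; apply/ffunP => k; rewrite ffunE.
by case: unliftP => [k' ->|->] /=; rewrite ?ffunE.
Qed.

Lemma joint_weightE (p : 'I_d -> F) P n i :
  joint_weight p P n i = \sum_r p r * word_weight P (mkseq i n.+1) r.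
Proof.
rewrite /joint_weight.
rewrite (partition_big (fun r : {ffun 'I_n.+1 -> 'I_d} => r ord0) xpredT) //.
apply: eq_bigr => r0 _; rewrite -sum_path_weight mulr_sumr.
by apply: eq_bigr => r /eqP <-.
Qed.

Lemma sum_path_weight_scale (V : lmodType F) (v : 'I_d -> V) P n i :
  \sum_(r : {ffun 'I_n.+1 -> 'I_d}) path_weight P i r *: v (r ord0) =
  \sum_r word_weight P (mkseq i n.+1) r *: v r.
Proof.
rewrite (partition_big (fun r : {ffun 'I_n.+1 -> 'I_d} => r ord0) xpredT) //.
apply: eq_bigr => r0 _; rewrite -sum_path_weight scaler_suml.
by apply: eq_bigr => r /eqP <-.
Qed.

End PathSums.

(** * Kronecker products, traces and adjoints *)

Section TensorProducts.
Context {C : numClosedFieldType}.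

Lemma sum_mxtens_index (V : nmodType) m n (F : 'I_(m * n) -> V) :
  \sum_k F k = \sum_i \sum_j F (mxtens_index (i, j)).
Proof.
rewrite pair_bigA /= (reindex (@mxtens_index m n)) /=.
  by apply: eq_bigr => -[].
by exists (@mxtens_unindex m n) => ? _; rewrite ?mxtens_indexK ?mxtens_unindexK.
Qed.

(** For the trace pairing, [ptrace2] is dual to tensoring with the identity. *)
Lemma mxtrace_ptrace2_mul m n (X : 'M[C]_(m * n)) (A : 'M[C]_m) :
  \tr (ptrace2 X *m A) = \tr (X *m (A *t (1%:M : 'M[C]_n))).
Proof.
rewrite /mxtrace sum_mxtens_index; apply: eq_bigr => i _.
under [RHS]eq_bigr => k _ do rewrite mxE sum_mxtens_index.
rewrite mxE exchange_big; apply: eq_bigr => j _ /=.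
rewrite mxE mulr_suml; apply: eq_bigr => k _.
rewrite (bigD1 k) //= big1 => [|l lk]; rewrite tensmxE mxE.
  by rewrite eqxx mulr1 addr0.
by rewrite (negPf lk) !mulr0.
Qed.

Lemma mxtrace_tens m n (A : 'M[C]_m) (B : 'M[C]_n) :
  \tr (A *t B) = \tr A * \tr B.
Proof.
rewrite /mxtrace sum_mxtens_index mulr_suml; apply: eq_bigr => i _.
by rewrite mulr_sumr; apply: eq_bigr => j _; rewrite tensmxE.
Qed.

Lemma tensmx11 m n : (1%:M : 'M[C]_m) *t (1%:M : 'M[C]_n) = 1%:M.
Proof.
apply/matrixP => k l.
have [i j] := mxtens_indexP k; have [i' j'] := mxtens_indexP l.
rewrite tensmxE !mxE.
by rewrite (can_eq (@mxtens_indexK m n)) xpair_eqE -natrM mulnb.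
Qed.

Lemma tensmx_suml (I : finType) m n p q (A : I -> 'M[C]_(m, n))
    (B : 'M[C]_(p, q)) :
  (\sum_i A i) *t B = \sum_i A i *t B.
Proof.
apply/matrixP => k l; rewrite !mxE !summxE mulr_suml.
by apply: eq_bigr => i _; rewrite !mxE.
Qed.

Lemma tensmx_sumr (I : finType) m n p q (A : 'M[C]_(m, n))
    (c : I -> C) (B : I -> 'M[C]_(p, q)) :
  A *t (\sum_i c i *: B i) = \sum_i c i *: (A *t B i).
Proof.
apply/matrixP => k l; rewrite !mxE !summxE mulr_sumr.
by apply: eq_bigr => i _; rewrite !mxE mulrCA.
Qed.

Lemma trmxC_mul m n p (A : 'M[C]_(m, n)) (B : 'M[C]_(n, p)) :
  (A *m B)^t* = B^t* *m A^t*.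
Proof. by rewrite trmx_mul map_mxM. Qed.

Lemma trmxC_tens m n p q (A : 'M[C]_(m, n)) (B : 'M[C]_(p, q)) :
  (A *t B)^t* = A^t* *t B^t*.
Proof. by rewrite trmx_tens map_mxT. Qed.

Lemma trmxC_sum (I : finType) m n (A : I -> 'M[C]_(m, n)) :
  (\sum_i A i)^t* = \sum_i (A i)^t*.
Proof. by rewrite linear_sum; apply: (raddf_sum (@map_mx _ _ conjC n m)). Qed.

End TensorProducts.

(** * Matrix units of an orthonormal basis *)

Section MatrixUnits.
Context {C : numClosedFieldType} {d : nat} {e : 'I_d -> 'cV[C]_d}.
Hypothesis e_on : orthonormal_basis e.
Local Notation mu := (matrix_unit e).

Lemma orthonormal_mulmx h k : (e h)^t* *m e k = (h == k)%:R%:M.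
Proof. by rewrite [LHS]mx11_scalar e_on. Qed.

Lemma matrix_unit_mul h k k' l :
  mu h k *m mu k' l = (k == k')%:R *: mu h l.
Proof.
rewrite /matrix_unit mulmxA -(mulmxA (e h)) orthonormal_mulmx.
by rewrite mul_mx_scalar scalemxAl.
Qed.

Lemma trmxC_matrix_unit h k : (mu h k)^t* = mu k h.
Proof. by rewrite trmxC_mul trmxCK. Qed.

Lemma mxtrace_matrix_unit h k : \tr (mu h k) = (h == k)%:R.
Proof.
by rewrite mxtrace_mulC orthonormal_mulmx mxtrace_scalar mulr1n eq_sym.
Qed.

(** Orthonormality says that the matrix [U] with columns [e j] has a left inverse, its adjoint; [U]
    being square, this is also a right inverse, which is completeness. *)
Lemma sum_matrix_unit : \sum_h mu h h = 1%:M.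
Proof.
pose U : 'M[C]_d := \matrix_(i, j) e j i 0.
have UU : U^t* *m U = 1%:M.
  apply/matrixP => h k; rewrite !mxE -e_on mxE.
  by apply: eq_bigr => i _; rewrite !mxE.
rewrite -(mulmx1C UU); apply/matrixP => i j; rewrite summxE mxE.
by apply: eq_bigr => h _; rewrite !mxE big_ord1 !mxE.
Qed.

Lemma diag_subalgE x :
  diag_subalg e x -> x = \sum_r \tr (x *m mu r r) *: mu r r.
Proof.
move=> [c ->]; apply: eq_bigr => r _; congr (_ *: _).
rewrite mulmx_suml (bigD1 r) //= big1 => [|h hr].
  by rewrite addr0 -scalemxAl matrix_unit_mul eqxx scale1r mxtraceZ
             mxtrace_matrix_unit eqxx mulr1.
by rewrite -scalemxAl matrix_unit_mul (negPf hr) scale0r scaler0.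
Qed.

End MatrixUnits.

(** * The transition expectation on the diagonal subalgebra *)

Section DiagonalTransition.
Context {C : numClosedFieldType} {d : nat} {e : 'I_d -> 'cV[C]_d}
  {J : finType} {Kc : J -> 'I_d -> 'I_d -> 'M[C]_d} {K : J -> 'M[C]_(d * d)}
  {E : 'M[C]_(d * d) -> 'M[C]_d}.
Hypothesis e_on : orthonormal_basis e.
Hypothesis E_lin : linear E.
Hypothesis E_1 : E 1%:M = 1%:M.
Hypothesis K_E : forall j, K j = \sum_h \sum_h' matrix_unit e h h' *t Kc j h h'.
Hypothesis E_E : forall x, E x = ptrace2 (\sum_j (K j)^t* *m x *m K j).
Hypothesis E_diag : forall x,
  tens_subspace (diag_subalg e) (diag_subalg e) x -> diag_subalg e (E x).
Local Notation mu := (matrix_unit e).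
Local Notation P := (kraus_weight e Kc).

Let El : {linear 'M[C]_(d * d) -> 'M[C]_d} :=
  HB.pack E (GRing.isLinear.Build _ _ _ _ E E_lin).

Let E_sum (I : finType) (x : I -> 'M[C]_(d * d)) :
  E (\sum_i x i) = \sum_i E (x i).
Proof. exact: (raddf_sum El). Qed.

Let E_scale c x : E (c *: x) = c *: E x.
Proof. exact: (linearZ_LR El). Qed.

Lemma kraus_mul_unit j r :
  K j *m (mu r r *t 1%:M) = \sum_h mu h r *t Kc j h r.
Proof.
rewrite K_E mulmx_suml; apply: eq_bigr => h _.
rewrite mulmx_suml (bigD1 r) //= big1 => [|h' hr].
  by rewrite tensmx_mul matrix_unit_mul // eqxx scale1r mulmx1 addr0.
by rewrite tensmx_mul matrix_unit_mul // (negPf hr) scale0r tens0mx.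
Qed.

(** Cutting [K j] by the projection [mu r r *t 1%:M] keeps its blocks in column [r], and [mu m m]
    then selects the one in row [m]. *)
Lemma transition_trace m r b :
  \tr (E (mu m m *t b) *m mu r r) =
  \sum_j \tr (b *m (Kc j m r *m (Kc j m r)^t*)).
Proof.
rewrite E_E mxtrace_ptrace2_mul mulmx_suml raddf_sum.
apply: eq_bigr => j _; set A := K j *m (mu r r *t 1%:M).
have A_unit : A = A *m (mu r r *t 1%:M).
  by rewrite -mulmxA tensmx_mul matrix_unit_mul // eqxx scale1r mulmx1.
(* The projection is self-adjoint and already absorbed by [A], so the second factor can be completed
   to the adjoint of [A]. *)
have AA : A *m A^t* = A *m (K j)^t*.
  rewrite [A^t*]trmxC_mul trmxC_tens trmxC_matrix_unit trmx1 map_mx1.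
  by rewrite mulmxA -A_unit.
rewrite /= -2!mulmxA -/A mxtrace_mulC -mulmxA -AA.
rewrite /A kraus_mul_unit trmxC_sum mulmx_suml.
rewrite mulmx_sumr raddf_sum /=.
have term h k : \tr ((mu m m *t b) *m ((mu h r *t Kc j h r) *m
     (mu k r *t Kc j k r)^t*)) =
   ((h == m) && (k == m))%:R * \tr (b *m (Kc j h r *m (Kc j k r)^t*)).
  rewrite trmxC_tens trmxC_matrix_unit !tensmx_mul !matrix_unit_mul //.
  rewrite eqxx scale1r matrix_unit_mul // mxtrace_tens.
  by rewrite mxtraceZ mxtrace_matrix_unit // -natrM mulnb eq_sym [m == k]eq_sym.
rewrite (bigD1 m) //= [X in _ + X]big1 ?addr0 => [|h hm].
  rewrite !mulmx_sumr raddf_sum (bigD1 m) //= big1 => [|k km].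
    by rewrite term !eqxx mul1r addr0.
  by rewrite term (negPf km) andbF mul0r.
rewrite !mulmx_sumr raddf_sum big1 //= => k _.
by rewrite term (negPf hm) mul0r.
Qed.

Lemma transition_weight r m i :
  \tr (E (mu m m *t mu i i) *m mu r r) = P r m i.
Proof.
rewrite transition_trace -raddf_sum -mulmx_sumr /kraus_weight /=.
by rewrite /matrix_unit mxtrace_mulC mulmxA mxtrace_mulC trace_mx11 mulmxA.
Qed.

Lemma transition_diag m i :
  E (mu m m *t mu i i) = \sum_r P r m i *: mu r r.
Proof.
under eq_bigr => r _ do rewrite -transition_weight.
apply: diag_subalgE => //; apply: E_diag.
exists [:: (mu m m, mu i i)]; split; last by rewrite big_seq1.
move=> ab; rewrite inE => /eqP ->.
have diag_unit k : diag_subalg e (mu k k).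
  exists (fun h => (h == k)%:R); rewrite (bigD1 k) //= big1 => [|h hk].
    by rewrite eqxx scale1r addr0.
  by rewrite (negPf hk) scale0r.
by split; apply: diag_unit.
Qed.

(** Each summand is the squared norm of the adjoint of [Kc j m r] applied to [e i]. *)
Lemma kraus_weight_ge0 r m i : 0 <= P r m i.
Proof.
rewrite /kraus_weight mulmx_sumr mulmx_suml summxE sumr_ge0 // => j _.
rewrite mulmxA -mulmxA -[X in X *m _]trmxCK trmxC_mul !trmxCK mxE.
by apply: sumr_ge0 => k _; rewrite !mxE mulrC mul_conjC_ge0.
Qed.

(** The double sum is the [r]-th diagonal coefficient of [E 1%:M], since the tensors
    [mu m m *t mu i i] add up to the identity. *)
Lemma kraus_weight_sum r : \sum_m \sum_i P r m i = 1.
Proof.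
transitivity (\tr (E 1%:M *m mu r r)); last first.
  by rewrite E_1 mul1mx mxtrace_matrix_unit // eqxx.
have -> : 1%:M = \sum_m \sum_i mu m m *t mu i i :> 'M[C]_(d * d).
  rewrite -tensmx11 -{1}(sum_matrix_unit e_on) tensmx_suml; apply: eq_bigr => m _.
  rewrite -(sum_matrix_unit e_on).
  under eq_bigr => i _ do rewrite -[mu i i]scale1r.
  by rewrite tensmx_sumr; under eq_bigr => i _ do rewrite scale1r.
rewrite E_sum mulmx_suml raddf_sum /=; apply: eq_bigr => m _.
rewrite E_sum mulmx_suml raddf_sum /=; apply: eq_bigr => i _.
by rewrite transition_weight.
Qed.

(** The induction runs from the innermost factor outwards: there the identity is the sum of the
    [mu r r], matching the weight 1 of the empty word. *)
Lemma nested_units s :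
  nested E [seq mu m m | m <- s] = \sum_r word_weight P s r *: mu r r.
Proof.
elim: s => [|m s IHs] /=.
  by rewrite -(sum_matrix_unit e_on); apply: eq_bigr => r _; rewrite scale1r.
rewrite IHs tensmx_sumr E_sum /=.
under eq_bigr => r' _ do rewrite E_scale transition_diag scaler_sumr.
rewrite exchange_big; apply: eq_bigr => r _ /=.
by rewrite scaler_suml; apply: eq_bigr => r' _; rewrite scalerA mulrC.
Qed.

Lemma nested_joint_weight (p : 'I_d -> C) n (i : nat -> 'I_d) :
  \tr ((\sum_r p r *: mu r r) *m
       nested E (mkseq (fun k => mu (i k) (i k)) n.+1)) =
  joint_weight p P n i.
Proof.
have -> : mkseq (fun k => mu (i k) (i k)) n.+1 =
          [seq mu m m | m <- mkseq i n.+1] by rewrite -map_comp.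
rewrite nested_units joint_weightE mulmx_suml raddf_sum /=.
apply: eq_bigr => r _; rewrite mulmx_sumr raddf_sum /=.
rewrite (bigD1 r) //= [X in _ + X]big1 => [|k kr].
  rewrite addr0 -scalemxAr -scalemxAl matrix_unit_mul // eqxx scale1r.
  by rewrite !mxtraceZ mxtrace_matrix_unit // eqxx mulr1 mulrC.
rewrite -scalemxAr -scalemxAl matrix_unit_mul // eq_sym.
by rewrite (negPf kr) scale0r !scaler0 mxtrace0.
Qed.

End DiagonalTransition.

(** * A process from nested subintervals of the unit interval *)

Section IntervalCoding.
Context {R : realType} {d : nat} (d0 : 'I_d) {w : seq 'I_d -> R}.
Hypothesis w_ge0 : forall s, 0 <= w s.
Hypothesis w_nil : w [::] = 1.
Hypothesis w_cons : forall s, \sum_j w (j :: s) = w s.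
Local Open Scope classical_set_scope.

(** Offset of the [m]-th child inside the interval of [s]; [m] is a plain number so that [m = d]
    gives the right end. *)
Definition cumulative (s : seq 'I_d) (m : nat) : R :=
  \sum_(k < d | (k < m)%N) w (k :: s).

Fixpoint word_left (s : seq 'I_d) : R :=
  if s is j :: s' then word_left s' + cumulative s' j else 0.

(* Words are read backwards: the head of [s] is its most recent letter. *)
Definition word_itv (s : seq 'I_d) : interval R :=
  `[word_left s, word_left s + w s[%R.

Lemma cumulative0 s : cumulative s 0 = 0.
Proof. by rewrite /cumulative big_pred0. Qed.

Lemma cumulative_total s : cumulative s d = w s.
Proof. by rewrite -w_cons; apply: eq_bigl => k; rewrite ltn_ord. Qed.

Lemma cumulativeS s (j : 'I_d) :
  cumulative s j.+1 = cumulative s j + w (j :: s).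
Proof.
rewrite /cumulative (bigD1 j) //= addrC; congr (_ + _); apply: eq_bigl => k.
by rewrite ltnS ltn_neqAle andbC.
Qed.

Lemma cumulative_le s m n : (m <= n)%N -> cumulative s m <= cumulative s n.
Proof.
move=> mn; rewrite /cumulative [leRHS](bigID (fun k : 'I_d => (k < m)%N)) /=.
rewrite [X in _ <= X + _](eq_bigl (fun k : 'I_d => (k < m)%N)) => [|k].
  by rewrite lerDl sumr_ge0.
by rewrite andb_idl // => km; apply: leq_trans mn.
Qed.

Lemma word_itv_consE j s x :
  (x \in word_itv (j :: s)) =
  (word_left s + cumulative s j <= x < word_left s + cumulative s j.+1).
Proof. by rewrite in_itv /= cumulativeS addrA. Qed.

Lemma word_itv_cons_sub {j s x} : x \in word_itv (j :: s) -> x \in word_itv s.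
Proof.
rewrite word_itv_consE in_itv /= => /andP[lx xr]; apply/andP; split.
  by apply: le_trans lx; rewrite lerDl -(cumulative0 s) cumulative_le.
by apply: lt_le_trans xr _; rewrite lerD2l -cumulative_total cumulative_le.
Qed.

Lemma word_itv_cons_exists {s x} :
  x \in word_itv s -> exists j, x \in word_itv (j :: s).
Proof.
rewrite in_itv /= => /andP[lx xr].
have ex_m : exists m, x < word_left s + cumulative s m.
  by exists d; rewrite cumulative_total.
(* The least cut to the right of [x] is not the one at 0, so [x] lies in the child just before
   it. *)
case: (ex_minnP ex_m) => -[|m] xm m_min.
  by move: xm; rewrite cumulative0 addr0 ltNge lx.
have md : (m < d)%N by apply: m_min; rewrite cumulative_total.
exists (Ordinal md); rewrite word_itv_consE xm andbT leNgt.
by apply/negP => /m_min; rewrite ltnn.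
Qed.

Lemma word_itv_cons_inj {s x j k} :
  x \in word_itv (j :: s) -> x \in word_itv (k :: s) -> j = k.
Proof.
wlog jk : j k / (j < k)%N => [wl xj xk|].
  have [jk|kj|/val_inj//] := ltngtP j k; first exact: wl xj xk.
  by apply/esym; apply: wl xk xj.
rewrite !word_itv_consE => /andP[_ xj] /andP[xk _].
have jk_le : word_left s + cumulative s j.+1 <= word_left s + cumulative s k.
  by rewrite lerD2l cumulative_le.
by have := lt_le_trans xj (le_trans jk_le xk); rewrite ltxx.
Qed.

Lemma word_itv_nil {s x} : x \in word_itv s -> x \in word_itv [::].
Proof. by elim: s => // j s IHs /word_itv_cons_sub. Qed.

Lemma word_itv_inj {s s' x} :
  size s = size s' -> x \in word_itv s -> x \in word_itv s' -> s = s'.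
Proof.
elim: s s' => [|j s IHs] [|j' s'] //= [ss'] xs xs'.
have ss : s = s'.
  by apply: IHs ss' _ _; [apply: word_itv_cons_sub xs |
                          apply: word_itv_cons_sub xs'].
by rewrite ss in xs *; congr (_ :: _); apply: word_itv_cons_inj xs xs'.
Qed.

Definition letter_set (n : nat) (j : 'I_d) : set R :=
  \bigcup_(s : n.-tuple 'I_d) [set` word_itv (j :: s)].

(* Off the unit interval the letter is the arbitrary [d0]. *)
Definition letter (n : nat) (x : R) : 'I_d :=
  odflt d0 [pick j | `[< letter_set n j x >]].

Lemma letter_setP {n j x} :
  letter_set n j x <-> exists2 s, size s = n & x \in word_itv (j :: s).
Proof.
split=> [[s _ xs]|[s /eqP sn xs]]; first by exists s; rewrite ?size_tuple.
by exists (Tuple sn).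
Qed.

Lemma letter_set_inj {n x j k} : letter_set n j x -> letter_set n k x -> j = k.
Proof.
move=> /letter_setP[s sn xj] /letter_setP[s' s'n xk].
by have [] : j :: s = k :: s' by apply: word_itv_inj xj xk; rewrite /= sn s'n.
Qed.

Lemma letterE {n x j} : letter_set n j x -> letter n x = j.
Proof.
move=> xj; rewrite /letter; case: pickP => [k /asboolP xk|/(_ j)/asboolP //].
exact: letter_set_inj xk xj.
Qed.

Lemma measurable_letter_set n j :
  measurable (letter_set n j : set (measurableTypeR R)).
Proof. by apply: fin_bigcup_measurable => // s _; apply: measurable_itv. Qed.

Lemma measurable_letter n (A : set 'I_d) :
  measurable (letter n @^-1` A : set (measurableTypeR R)).
Proof.
(* Points in no letter set are sent to [d0], so they join the preimage exactly when [d0] lies in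
   [A]. *)
have -> : letter n @^-1` A =
    \bigcup_(j in A) letter_set n j `|`
    (if d0 \in A then ~` (\bigcup_j letter_set n j) else set0).
  apply/seteqP; split => x /=.
    rewrite /letter; case: pickP => [j /asboolP xj Aj|x_no Ad0].
      by left; exists j.
    right; rewrite ifT ?inE // => -[j _ /asboolP xj].
    by have := x_no j; rewrite xj.
  case=> [[j Aj /letterE -> //]|]; case: ifPn => // /set_mem Ad0 xnot.
  rewrite /letter; case: pickP => [j /asboolP xj|//].
  by case: xnot; exists j.
apply: measurableU.
  by apply: fin_bigcup_measurable => // j _; apply: measurable_letter_set.
case: ifP => // _; apply: measurableC.
by apply: fin_bigcup_measurable => // j _; apply: measurable_letter_set.
Qed.

(** Intersecting with the unit interval discards the points where letters take the default value;
    [rev] turns time order into most recent letter first. *)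
Lemma letters_word n (i : nat -> 'I_d) :
  [set x | forall t, t \in iota 0 n -> letter t x = i t] `&`
    [set` word_itv [::]] =
  [set` word_itv (rev (mkseq i n))].
Proof.
elim: n => [|n IHn].
  by apply/seteqP; split => [x [_ x01]|x x01]; [exact: x01 | split].
rewrite mkseqS rev_rcons; apply/seteqP; split => x.
  move=> [xi x01]; have : (x \in word_itv (rev (mkseq i n))).
    suff : [set` word_itv (rev (mkseq i n))] x by [].
    rewrite -IHn; split => // t tn; apply: xi.
    by move: tn; rewrite !mem_iota !add0n ltnS; exact: ltnW.
  move=> xn; have [j xj] := word_itv_cons_exists xn.
  have <- : j = i n; last exact: xj.
  rewrite -(xi n) ?mem_iota /= ?add0n //; apply/esym/letterE/letter_setP.
  by exists (rev (mkseq i n)); rewrite ?size_rev ?size_mkseq.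
move=> xn; split; last exact: word_itv_nil xn.
move=> t; rewrite mem_iota /= add0n ltnS leq_eqVlt => /orP[/eqP ->|tn].
  apply/letterE/letter_setP.
  by exists (rev (mkseq i n)); rewrite ?size_rev ?size_mkseq.
have : [set` word_itv (rev (mkseq i n))] x by apply: word_itv_cons_sub xn.
by rewrite -IHn => -[+ _]; apply; rewrite mem_iota.
Qed.

Lemma interval_coding_process :
  exists X : process R d, forall n i,
    joint_prob X (iota 0 n) i = (w (rev (mkseq i n)))%:E.
Proof.
pose mu := @lebesgue_measure R.
have word_measure s : mu [set` word_itv s] = (w s)%:E.
  rewrite /mu lebesgue_measure_itv /= lte_fin -EFinB addrAC subrr add0r ltrDl.
  (* A word of weight 0 has an empty half-open interval, of measure 0. *)
  by case: ltP => // ws; congr EFin; apply/le_anti; rewrite ws w_ge0.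
have m01 : measurable ([set` word_itv [::]] : set (measurableTypeR R)).
  exact: measurable_itv.
have setT1 : mrestr mu m01 setT = 1%E.
  by rewrite /mrestr setTI word_measure w_nil.
pose Pr : probability (measurableTypeR R) R :=
  HB.pack (mrestr mu m01) (Measure_isProbability.Build _ _ _ _ setT1).
exists (Process Pr measurable_letter) => n i.
(* The restricted measure intersects the event with [word_itv [::]], exactly as in
   [letters_word]. *)
by rewrite -word_measure -letters_word.
Qed.

End IntervalCoding.

(** * Joint probabilities from initial segments *)

Section FiniteDimensionalLaws.
Context {R : realType} {d : nat}.
Local Open Scope classical_set_scope.

Lemma measurable_joint_event (X : process R d) (ts : seq nat)
    (i : nat -> 'I_d) :
  measurable [set w | forall t, t \in ts -> @proc_var R d X t w = i t].
Proof.
apply: (@bigcap_measurableType _ _ (fun t => @proc_var R d X t @^-1` [set i t])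
  [set` ts]) => t _.
exact: proc_measurable.
Qed.

(** The event is partitioned by the whole trajectory up to time [n]; [inord] never truncates, as all
    times involved are at most [n]. *)
Lemma joint_prob_total (X : process R d) (ts : seq nat) (i : nat -> 'I_d) n :
  (forall t, t \in ts -> (t < n.+1)%N) ->
  joint_prob X ts i =
  (\sum_(f \in [set f : {ffun 'I_n.+1 -> 'I_d} |
                 forall t, t \in ts -> f (inord t) = i t])
     joint_prob X (iota 0 n.+1) (fun t => f (inord t)))%E.
Proof.
move=> tsn; rewrite /joint_prob -measure_fin_bigcup //; last first.
- move=> f _.
  exact: (measurable_joint_event X (iota 0 n.+1) (fun t => f (inord t))).
- move=> f g _ _ [w [/= wf wg]]; apply/ffunP => t.
  have tn : (t : nat) \in iota 0 n.+1 by rewrite mem_iota add0n ltn_ord.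
  by have := wg _ tn; rewrite (wf _ tn) !inord_val.
- exact: finite_finset.
congr (proc_prob X _); apply/seteqP; split => w.
  move=> wi; exists [ffun k : 'I_n.+1 => @proc_var R d X k w] => t tts.
    by rewrite ffunE inordK ?tsn // wi.
  by rewrite ffunE inordK //; move: tts; rewrite mem_iota.
by move=> [f fi wf] t tts; rewrite wf ?fi // mem_iota add0n tsn.
Qed.

Lemma stochastically_equivalent_of_initial (X Y : process R d) :
  (forall n i, joint_prob X (iota 0 n.+1) i = joint_prob Y (iota 0 n.+1) i) ->
  stochastically_equivalent X Y.
Proof.
move=> XY ts i; pose n := \max_(t <- ts) t.
have tsn t : t \in ts -> (t < n.+1)%N.
  by move=> tts; rewrite ltnS; apply: (@leq_bigmax_seq _ _ xpredT id t).
by rewrite !(joint_prob_total _ _ _ _ tsn); apply: eq_fsbigr => f _; apply: XY.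
Qed.

End FiniteDimensionalLaws.

(** * Consistency of the weights and existence of the process *)

Section HiddenMarkovWeights.
Context {R : realType} {d : nat} {P : 'I_d -> 'I_d -> 'I_d -> R}
  {p : 'I_d -> R}.
Hypothesis P_stoch : stochastic3 P.
Hypothesis p_prob : probability_vector p.

Lemma word_weight_ge0 s r : 0 <= word_weight P s r.
Proof.
have [P_ge0 _] := P_stoch.
by elim: s r => //= m s IHs r; apply: sumr_ge0 => k _; apply: mulr_ge0.
Qed.

(** This is Kolmogorov consistency: the recursion carries the sum over the last letter down to the
    empty word, where it is the normalization of [P]. *)
Lemma word_weight_rcons s r :
  \sum_j word_weight P (rcons s j) r = word_weight P s r.
Proof.
have [_ P_sum] := P_stoch.
elim: s r => [|m s IHs] r /=.
  rewrite -[RHS](P_sum r); apply: eq_bigr => m _.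
  by apply: eq_bigr => k _; rewrite mulr1.
rewrite exchange_big; apply: eq_bigr => k _ /=.
by rewrite -mulr_sumr IHs.
Qed.

Lemma hidden_markov_process_exists :
  exists X : process R d, has_joint_weights p P X.
Proof.
have [p_ge0 p_sum] := p_prob.
(* An empty sum cannot be 1; this provides the default letter. *)
have d_gt0 : (0 < d)%N.
  have /eqP := p_sum; apply: contraTltn => d_le0; rewrite big1 => [|k].
    by rewrite eq_sym oner_eq0.
  by have := leq_trans (ltn_ord k) d_le0; rewrite ltn0.
(* The interval coding has the newest letter at the head, whereas [word_weight] starts from time 0;
   hence [rev]. *)
pose w s := \sum_r p r * word_weight P (rev s) r.
have w_ge0 s : 0 <= w s.
  by apply: sumr_ge0 => r _; rewrite mulr_ge0 // word_weight_ge0.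
have w_nil : w [::] = 1.
  by rewrite -[RHS]p_sum; apply: eq_bigr => r _; rewrite mulr1.
have w_cons s : \sum_j w (j :: s) = w s.
  rewrite exchange_big; apply: eq_bigr => r _ /=.
  rewrite -mulr_sumr -word_weight_rcons; congr (_ * _).
  by apply: eq_bigr => j _; rewrite rev_cons.
have [X XE] := interval_coding_process (Ordinal d_gt0) w_ge0 w_nil w_cons.
by exists X => n i; rewrite XE joint_weightE /w revK.
Qed.

End HiddenMarkovWeights.

Theorem theorem13 (R : realType) (d : nat) :
  (forall (e : 'I_d -> 'cV[R[i]]_d)
      (J : finType)
      (Kc : J -> 'I_d -> 'I_d -> 'M[R[i]]_d)
      (K : J -> 'M[R[i]]_(d * d))
      (E : 'M[R[i]]_(d * d) -> 'M[R[i]]_d),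
    orthonormal_basis e ->
    transition_expectation E ->
    (forall j, K j = \sum_h \sum_h' matrix_unit e h h' *t Kc j h h') ->
    (forall x, E x = ptrace2 (\sum_j (K j)^t* *m x *m K j)) ->
    (forall x, tens_subspace (diag_subalg e) (diag_subalg e) x ->
       diag_subalg e (E x)) ->
    let P := kraus_weight e Kc in
    [/\ stochastic3 P,
        forall (n : nat) (i : nat -> 'I_d),
          nested E (mkseq (fun k => matrix_unit e (i k) (i k)) n.+1) =
          \sum_(r : {ffun 'I_n.+1 -> 'I_d})
             path_weight P i r *: matrix_unit e (r ord0) (r ord0)
      & forall (p0 : 'I_d -> R)
          (phi : forall n, 'M[R[i]]_(loc_dim d n) -> R[i]),
          probability_vector p0 ->
          homogeneous_qmc
            (fun x => \tr ((\sum_i (p0 i)%:C *: matrix_unit e i i) *m x))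
            E phi ->
          forall (n : nat) (i : nat -> 'I_d),
            phi n (pure_tensor (fun k => matrix_unit e (i k) (i k)) n) =
            joint_weight (fun r => (p0 r)%:C) P n i])
  /\
  (forall (P : 'I_d -> 'I_d -> 'I_d -> R) (p0 : 'I_d -> R),
    stochastic3 P -> probability_vector p0 ->
    exists X : process R d,
      has_joint_weights p0 P X /\
      forall Y : process R d,
        has_joint_weights p0 P Y -> stochastically_equivalent X Y).
Proof.
split=> [e J Kc K E e_on [E_lin _ E_1] K_E E_E E_diag P|P p P_stoch p_prob].
  split.
  - split=> [r m i|r]; first exact: kraus_weight_ge0.
    exact: kraus_weight_sum e_on E_lin E_1 K_E E_E r.
  - move=> n i; rewrite (sum_path_weight_scale _ (fun r => matrix_unit e r r)).
    by rewrite -(nested_units e_on E_lin K_E E_E E_diag) -map_comp.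
  - move=> p phi _ [_ phiE] n i; rewrite phiE.
    exact: nested_joint_weight e_on E_lin K_E E_E E_diag _ _ _.
have [X XE] := hidden_markov_process_exists P_stoch p_prob.
exists X; split=> // Y YE; apply: stochastically_equivalent_of_initial => n i.
by rewrite XE YE.
Qed.
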